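(* Let $\mathbf{V}$ be a permutative pseudovariety of semigroups. Then $C^2_{\mathbf{V}}(N) \in \mathcal{O}(\log N)$.
   Context: A pseudovariety is a class of finite semigroups closed under finite direct products, subsemigroups, and homomorphic images. It is permutative if there are $n \geq 1$ and a nontrivial permutation $\sigma \in \mathrm{Sym}(n)$ such that every member of $\mathbf{V}$ satisfies the (common) identity $x_1 \cdots x_n = x_{\sigma(1)} \cdots x_{\sigma(n)}$. Straight-line programs. Let $S$ be a finite semigroup and $\Sigma \subseteq S$. A straight-line program over $\Sigma$ is a finite sequence of instructions executed in order and operating on registers $r_1, r_2, \dots$, each able to store one element of $S$. Each instruction is either $r_k \gets s$ for some $s \in \Sigma$, or $r_k \gets r_i \cdot r_j$, where $i,j,k$ need not be distinct and $r_i, r_j$ must have been assigned by previous instructions. Its length is the number of its instructions, its width is the number of registers it operates on. It computes $t \in S$ if upon completion some register contains $t$. For $2 \leq w \leq \infty$, $c^w_S(t;\Sigma)$ denotes the minimal length of a straight-line program over $\Sigma$ of width at most $w$ computing $t$. Put $C^w_S = \max\{c^w_S(t;\Sigma) : \Sigma \subseteq S,\ t \in \langle \Sigma \rangle\}$, where $\langle\Sigma\rangle$ is the subsemigroup generated by $\Sigma$, and $C^w_{\mathbf{V}}(N) = \max\{C^w_S : S \in \mathbf{V}, |S| \leq N\}$. Asymptotics are for $N \to \infty$. *)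

(* Defs.v *)
From HB Require Import structures.
From mathcomp Require Import all_boot.

(* Declared before [fingroup] is loaded: a finite semigroup structure cannot be
   inserted below its finite star-monoids afterwards. *)
#[short(type="finSemigroupType")]
HB.structure Definition FinSemigroup := {S of Semigroup S & Finite S}.

From mathcomp Require Import all_order all_fingroup all_algebra.
From mathcomp Require Import all_classical all_reals all_analysis.

Set Implicit Arguments.
Unset Strict Implicit.
Unset Printing Implicit Defensive.

Local Open Scope classical_set_scope.
Local Open Scope group_scope.

Section DirectProduct.
Variables (I : finType) (S : I -> finSemigroupType).

Definition dprod_mul (f g : {dffun forall i, S i}) : {dffun forall i, S i} :=
  [ffun i => f i * g i].

Fact dprod_mulA : associative dprod_mul.
Proof. by move=> f g h; apply/ffunP => i; rewrite !ffunE mulgA. Qed.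

HB.instance Definition _ :=
  isSemigroup.Build {dffun forall i, S i} dprod_mulA.

End DirectProduct.

(* [I] may be empty, so the trivial semigroup belongs to every pseudovariety.
   Subsemigroups are taken up to isomorphism, as injective morphisms.  The empty
   type carries a [finSemigroupType] structure; requiring subsemigroups to be
   nonempty keeps the definition correct for the usual convention that
   semigroups are nonempty. *)
Record pseudovariety (V : finSemigroupType -> Prop) : Prop := Pseudovariety {
  pv_prod : forall (I : finType) (S : I -> finSemigroupType),
    (forall i, V (S i)) -> V {dffun forall i, S i};
  pv_sub : forall (S T : finSemigroupType) (f : {multiplicative T -> S}),
    (0 < #|T|)%N -> injective f -> V S -> V T;
  pv_image : forall (S T : finSemigroupType) (f : {multiplicative S -> T}),
    (forall t, exists s, f s = t) -> V S -> V T
}.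

(* The product x_0 x_1 ... x_n of n.+1 factors (a semigroup has no unit, so
   [\prod] is not available). *)
Fixpoint sprod (S : semigroupType) (n : nat) : ('I_n.+1 -> S) -> S :=
  match n with
  | 0 => fun x => x ord0
  | m.+1 => fun x => x ord0 * sprod (fun i : 'I_m.+1 => x (lift ord0 i))
  end.

Definition permutative (V : finSemigroupType -> Prop) : Prop :=
  exists (n : nat) (sigma : 'S_n.+1), sigma != 1 /\
    forall S : finSemigroupType, V S ->
      forall x : 'I_n.+1 -> S, sprod x = sprod (fun i => x (sigma i)).

Inductive instr (S : Type) :=
  | Const (k : nat) (s : S)     (* r_k <- s *)
  | Mul (k i j : nat).          (* r_k <- r_i * r_j *)
Arguments Mul {S}.

Definition instr_regs S (a : instr S) : seq nat :=
  match a with Const k _ => [:: k] | Mul k i j => [:: k; i; j] end.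

Definition slp_width S (p : seq (instr S)) : nat :=
  size (undup (flatten [seq instr_regs a | a <- p])).

Section SLP.
Variable S : finSemigroupType.
Implicit Types (Sigma : {set S}) (p : seq (instr S)) (t : S).

(* In a register state [r : nat -> option S], [None] marks an unassigned
   register.  The result is [None] if [p] is not a program over [Sigma], or if
   it reads an unassigned register. *)
Fixpoint slp_run Sigma p (r : nat -> option S) : option (nat -> option S) :=
  match p with
  | [::] => Some r
  | Const k s :: p' =>
      if s \in Sigma then slp_run Sigma p' [eta r with k |-> Some s] else None
  | Mul k i j :: p' =>
      if (r i, r j) is (Some a, Some b)
      then slp_run Sigma p' [eta r with k |-> Some (a * b)] else None
  end.

Definition slp_computes Sigma p t : Prop :=
  exists2 r, slp_run Sigma p (fun=> None) = Some r & exists k, r k = Some t.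

Definition subsemigroup (A : {set S}) : bool :=
  [forall x in A, forall y in A, x * y \in A].

Definition gen_sg Sigma : {set S} :=
  (\bigcap_(A : {set S} | (Sigma \subset A) && subsemigroup A) A)%SET.

End SLP.

(* The default value is 0.  By [slp_cost_attained] and [C_pv_max] below, the sets
   in [slp_cost] (for [t] in [gen_sg Sigma]) and [C_pv] have a least, resp.
   greatest, element whenever [2 <= w] and some member of [V] has at most [N]
   elements. *)
Definition nat_min (A : set nat) : nat :=
  xget 0 [set m | A m /\ forall k, A k -> (m <= k)%N].
Definition nat_max (A : set nat) : nat :=
  xget 0 [set m | A m /\ forall k, A k -> (k <= m)%N].

Definition slp_cost (w : nat) (S : finSemigroupType) (Sigma : {set S}) (t : S)
    : nat :=
  nat_min [set l | exists p, [/\ size p = l, (slp_width p <= w)%N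
                               & slp_computes Sigma p t]].

Definition C_sg (w : nat) (S : finSemigroupType) : nat :=
  \max_(Sigma : {set S}) \max_(t in gen_sg Sigma) slp_cost w Sigma t.

Definition C_pv (w : nat) (V : finSemigroupType -> Prop) (N : nat) : nat :=
  nat_max [set m | exists S : finSemigroupType,
                     [/\ V S, (#|S| <= N)%N & m = C_sg w S]].

Lemma nat_minP (A : set nat) : A !=set0 ->
  A (nat_min A) /\ forall k, A k -> (nat_min A <= k)%N.
Proof.
move=> [a Aa]; have exA : exists n, `[< A n >] by exists a; apply/asboolP.
rewrite /nat_min; case: xgetP => [//|/(_ (ex_minn exA))[]].
by case: ex_minnP => m /asboolP Am le_m; split=> // k Ak; apply/le_m/asboolP.
Qed.

Lemma nat_maxP (A : set nat) (b : nat) : A !=set0 ->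
  (forall k, A k -> (k <= b)%N) ->
  A (nat_max A) /\ forall k, A k -> (k <= nat_max A)%N.
Proof.
move=> [a Aa] Ab; have exA : exists n, `[< A n >] by exists a; apply/asboolP.
have ubA n : `[< A n >] -> (n <= b)%N by move=> /asboolP/Ab.
rewrite /nat_max; case: xgetP => [//|/(_ (ex_maxn exA ubA))[]].
by case: ex_maxnP => m /asboolP Am le_m; split=> // k Ak; apply/le_m/asboolP.
Qed.

Section Attained.
Variables (S : finSemigroupType) (Sigma : {set S}).

Let step (x y : S) := [exists s in Sigma, y == x * s].

Let gen_path (t : S) : t \in gen_sg Sigma ->
  exists x p, [/\ x \in Sigma, path step x p & last x p = t].
Proof.
pose P t := exists x p, [/\ x \in Sigma, path step x p & last x p = t].
have stepM z x y : step x y -> step (z * x) (z * y).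
  move=> /exists_inP[s sS /eqP->]; apply/exists_inP; exists s => //.
  by rewrite mulgA.
pose A := [set t | `[< P t >]]%SET; have PA u : (u \in A) = `[< P u >].
  by rewrite inE.
move=> /bigcapP/(_ A); rewrite PA => tA; apply/asboolP/tA/andP; split.
  by apply/fintype.subsetP => x xS; rewrite PA; apply/asboolP; exists x, [::].
apply/forall_inP => u; rewrite PA => /asboolP[x [p [xS px <-]]].
apply/forall_inP => v; rewrite PA => /asboolP[y [q [yS qy <-]]].
rewrite PA; apply/asboolP; set z := last x p.
exists x, (p ++ [seq z * a | a <- y :: q]); split=> //.
- rewrite cat_path px /=; apply/andP; split.
    by apply/exists_inP; exists y.
  by rewrite path_map; apply: sub_path qy => a b; apply: stepM.
- by rewrite last_cat /= last_map.
Qed.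

Let path_prog (x : S) q (r : nat -> option S) : r 0%N = Some x -> path step x q ->
  exists p : seq (instr S),
    [/\ size p = (2 * size q)%N,
        all (fun k => k \in [:: 0; 1]%N)
          (flatten [seq instr_regs a | a <- p])
      & exists2 r', slp_run Sigma p r = Some r' & r' 0%N = Some (last x q)].
Proof.
elim: q x r => [|y q IHq] x r rx /=; first by exists [::]; split=> //; exists r.
move=> /andP[/exists_inP[s sS /eqP->] qy].
pose r1 := [eta r with 1%N |-> Some s].
have r2x : [eta r1 with 0%N |-> Some (x * s)] 0%N = Some (x * s) by [].
have [p [sp pp [r' runp lp]]] := IHq _ _ r2x qy.
exists [:: Const 1 s, Mul 0 0 1 & p]; split.
- by rewrite /= sp mulnS.
- by rewrite /=.
- by exists r'; rewrite //= sS /= rx.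
Qed.

Let short_prog (t : S) : t \in gen_sg Sigma ->
  exists p : seq (instr S), [/\ (size p <= 2 * #|S|)%N, (slp_width p <= 2)%N
    & slp_computes Sigma p t].
Proof.
move=> /gen_path[x [q0 [xS]]] /shortenP[q qx uq _] <-.
have := max_card (mem (x :: q)); rewrite (card_uniqP uq) /= => szq.
have [p [sp pp [r' runp lp]]] :=
  @path_prog x q [eta (fun=> None) with 0%N |-> Some x] erefl qx.
exists (Const 0 x :: p); split.
- rewrite /= sp; apply: leq_trans (leq_mul (leqnn 2) szq).
  by rewrite mulnS addSn ltnS leq_addl.
- apply: (@uniq_leq_size _ _ [:: 0; 1]%N); first exact: undup_uniq.
  by move=> k; rewrite mem_undup inE => /predU1P[->//|/(allP pp)].
- by exists r'; [rewrite /= xS | exists 0%N].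
Qed.

Lemma slp_cost_attained (w : nat) (t : S) : (2 <= w)%N -> t \in gen_sg Sigma ->
  (exists p, [/\ size p = slp_cost w Sigma t, (slp_width p <= w)%N
               & slp_computes Sigma p t]) /\
  (forall p, (slp_width p <= w)%N -> slp_computes Sigma p t ->
     (slp_cost w Sigma t <= size p)%N).
Proof.
move=> w2 /short_prog[p [_ wp cp]].
have [|h1 h2] := @nat_minP [set l | exists p, [/\ size p = l,
  (slp_width p <= w)%N & slp_computes Sigma p t]].
  by exists (size p), p; split=> //; apply: leq_trans w2.
by split=> // q wq cq; apply: h2; exists q.
Qed.

Lemma slp_cost_le (w : nat) (t : S) : (2 <= w)%N -> t \in gen_sg Sigma ->
  (slp_cost w Sigma t <= 2 * #|S|)%N.
Proof.
move=> w2 tS; have [p [sp wp cp]] := short_prog tS.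
have [_ /(_ p)] := slp_cost_attained w2 tS.
by move=> /(_ (leq_trans wp w2) cp) /leq_trans; apply.
Qed.

End Attained.

Lemma C_pv_max (w : nat) (V : finSemigroupType -> Prop) (N : nat) :
    (2 <= w)%N -> (exists2 S, V S & (#|S| <= N)%N) ->
  (exists S : finSemigroupType, [/\ V S, (#|S| <= N)%N & C_pv w V N = C_sg w S])
  /\ (forall S : finSemigroupType, V S -> (#|S| <= N)%N ->
        (C_sg w S <= C_pv w V N)%N).
Proof.
move=> w2 [S0 VS0 S0N].
have [|k [S [_ SN ->]]|h1 h2] := @nat_maxP [set m | exists S : finSemigroupType,
    [/\ V S, (#|S| <= N)%N & m = C_sg w S]] (2 * N).
- by exists (C_sg w S0), S0.
- apply/bigmax_leqP => Sigma _; apply/bigmax_leqP => t tS.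
  by apply: leq_trans (slp_cost_le w2 tS) _; rewrite leq_pmul2l.
- by split=> // S VS SN; apply: h2; exists S.
Qed.

(* Main.v *)
From HB Require Import structures.
Require Import Defs.
From mathcomp Require Import all_boot all_order all_fingroup all_algebra.
From mathcomp Require Import all_classical all_reals all_analysis.
From mathcomp Require Import zify.
Import numFieldNormedType.Exports.

(** Let [S] satisfy a nontrivial permutation identity of length [n.+1].

    Commutation.  Since the permutation is not the identity, some adjacent
    letters [i], [i.+1] of the left-hand side are not consecutive, in this
    order, on the right-hand side.  Substitute a product of two letters, once
    [x_i * y] for [x_i] and once [y * x_(i.+1)] for [x_(i.+1)].  The left-hand
    sides become the same word, so the right-hand sides have the same value;
    they differ only in the position of [y], which has jumped over a fixed
    positive number of letters ([perm_identity_jump]).  Combining a jump over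
    [j] letters with one over [j.+1] letters transposes two adjacent letters.
    Hence there is [m], depending only on the identity, such that letters
    preceded by at least [m] letters and followed by at least [m] letters may
    be permuted at will ([perm_identity_perm_eq]).

    Short representation.  Let [t] be a product of generators.  A word of length
    at most [2 * m.+1] costs [O(1)].  Otherwise keep the first [m.+1] letters
    [p] and the last [m.+1] letters [q], and look at the middle as a multiset [w].
    Choose [w] of minimal size and, among those, with the largest sum of squared
    multiplicities.  If two distinct sub-multisets [f], [f'] of [w] satisfied
    [p f = p f'], then both [w - f + f'] and [w - f' + f] could replace [w]; by
    minimality they have the size of [w], and by strict convexity of the square
    one of them has a larger sum of squares, which is a contradiction.  So
    [f |-> p f] is injective and the number of sub-multisets, which is the
    product of the [multiplicity + 1], is at most [#|S|]
    ([optimal_num_subwords]).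

    Program.  A Horner scheme evaluates the middle with two registers: up to
    order, [w = h h b] where [h] has the halved multiplicities and [b] consists
    of the letters of odd multiplicity.  One squaring and [2 * size b] further
    instructions lead from [h] to [w], and the number of sub-multisets grows
    accordingly, so that the length [l] of the program satisfies
    [2 ^ l <= #|S| ^ 3] ([horner_program]).  Multiplying by [p] and [q] costs a
    constant. *)

Set Implicit Arguments.
Unset Strict Implicit.

(** * Values of words *)

Section Words.
Variable S : semigroupType.
Implicit Types (x y s t : S) (u v w E : seq S).

(** Semigroups have no unit; [None] is adjoined as one so that iterated
    operators and their splitting lemmas apply to words. *)
Definition omul (a b : option S) : option S :=
  match a, b with
  | Some x, Some y => Some (x * y)%g
  | None, _ => b
  | _, None => a
  end.

Fact omulA : associative omul.
Proof. by move=> [x|] [y|] [z|] //=; rewrite mulgA. Qed.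
Fact omul0l : left_id None omul. Proof. by case. Qed.
Fact omul0r : right_id None omul. Proof. by case. Qed.

HB.instance Definition _ :=
  Monoid.isLaw.Build (option S) None omul omulA omul0l omul0r.

Definition oprod w : option S := \big[omul/None]_(s <- w) Some s.

Lemma oprod_cat u v : oprod (u ++ v) = omul (oprod u) (oprod v).
Proof. exact: big_cat. Qed.

Lemma oprod_cons x w : oprod (x :: w) = omul (Some x) (oprod w).
Proof. exact: big_cons. Qed.

Lemma oprod1 x : oprod [:: x] = Some x.
Proof. by rewrite /oprod big_seq1. Qed.

Lemma oprod_rcons w x : oprod (rcons w x) = omul (oprod w) (Some x).
Proof. by rewrite -cats1 oprod_cat oprod1. Qed.

Lemma oprod_flatten (ws ws' : seq (seq S)) :
  map oprod ws = map oprod ws' -> oprod (flatten ws) = oprod (flatten ws').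
Proof.
elim: ws ws' => [|w ws IH] [|w' ws'] //= [eq_w eq_ws].
by rewrite !oprod_cat eq_w (IH _ eq_ws).
Qed.

Lemma oprodE w : w != [::] -> exists t, oprod w = Some t.
Proof.
case: w => // x w _; rewrite oprod_cons.
by case: (oprod w) => [t|]; [exists (x * t)%g | exists x].
Qed.

Lemma oprod_sprod n (x : 'I_n.+1 -> S) :
  Some (sprod x) = oprod [seq x i | i <- enum 'I_n.+1].
Proof.
elim: n x => [|n IHn] x.
  by rewrite enum_ordSl /= oprod_cons (size0nil (size_enum_ord 0)) /oprod big_nil.
by rewrite enum_ordSl /= oprod_cons -map_comp -IHn.
Qed.

End Words.

(** * Commutation from a permutation identity *)

Lemma split_at2 (T : Type) (x0 : T) (L : seq T) (a b : nat) :
    a < b < size L ->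
  exists A B C,
    [/\ L = A ++ nth x0 L a :: B ++ nth x0 L b :: C & size B = b - a.+1].
Proof.
case/andP=> ab bL; exists (take a L), (take (b - a.+1) (drop a.+1 L)), (drop b.+1 L).
split; last by rewrite size_takel // size_drop leq_sub2r // ltnW.
have -> : drop b.+1 L = drop (b - a.+1).+1 (drop a.+1 L).
  by rewrite drop_drop addSn subnK.
have -> : nth x0 L b = nth x0 (drop a.+1 L) (b - a.+1) by rewrite nth_drop subnKC.
rewrite -drop_nth ?size_drop ?ltn_sub2r ?cat_take_drop //; last first.
  exact: leq_ltn_trans bL.
by rewrite -drop_nth ?cat_take_drop // (ltn_trans ab).
Qed.

Section PermutationIdentity.
Variables (n : nat) (sigma : 'S_n.+1).

(** Otherwise [sigma^-1] would be a shift, and the only shift that maps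
    ['I_n.+1] into itself is the identity. *)
Lemma perm_breaks_succ : sigma != 1%g ->
  exists i i' : 'I_n.+1,
    i' = i.+1 :> nat /\ (sigma^-1)%g i' <> ((sigma^-1)%g i).+1 :> nat.
Proof.
move=> sigma1; apply: contrapT => /forallNP noi.
have step (i i' : 'I_n.+1) : i' = i.+1 :> nat ->
    (sigma^-1)%g i' = ((sigma^-1)%g i).+1 :> nat.
  by move=> ii'; apply: contrapT => neq; apply: (noi i); exists i'.
have shift k : forall i : 'I_n.+1, i = k :> nat ->
    (sigma^-1)%g i = (sigma^-1)%g ord0 + k :> nat.
  elim: k => [|k IHk] i ik.
    by rewrite addn0; have -> : i = ord0 by apply: val_inj.
  have kn : k < n.+1 by rewrite -ltnS ltnW // ltnS -ik ltn_ord.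
  by rewrite (step (Ordinal kn)) // (IHk (Ordinal kn)) // addnS.
have fix0 : (sigma^-1)%g ord0 = 0 :> nat.
  have := ltn_ord ((sigma^-1)%g ord_max); rewrite (shift n) //; lia.
move/eqP: sigma1; apply; apply: invg_inj; rewrite invg1; apply/permP => i.
by apply: val_inj; rewrite /= perm1 (shift i) // fix0.
Qed.

Definition satisfies_perm (S : semigroupType) : Prop :=
  forall x : 'I_n.+1 -> S, sprod x = sprod (fun i => x (sigma i)).

(** A nonempty word has a value in [S], which may be substituted for a letter. *)
Lemma perm_identity_words (S : semigroupType) (X : 'I_n.+1 -> seq S) :
    satisfies_perm S -> (forall i, X i != [::]) ->
  oprod (flatten (map X (enum 'I_n.+1))) =
  oprod (flatten (map X (map sigma (enum 'I_n.+1)))).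
Proof.
move=> idS X0; have [x xE] := fin_all_exists (fun i => oprodE (X0 i)).
have flatE L : oprod (flatten (map X L)) = oprod (map x L).
  rewrite (@oprod_flatten _ _ [seq [:: x i] | i <- L]) ?flatten_map1 //.
  by rewrite -!map_comp; apply: eq_map => i /=; rewrite xE oprod1.
by rewrite !flatE -oprod_sprod idS oprod_sprod -[in RHS]map_comp.
Qed.

Lemma flatten_subst_off (T : eqType) (U : Type) (x : T -> U) (W : seq U)
    (i : T) (M : seq T) :
  i \notin M -> flatten [seq if j == i then W else [:: x j] | j <- M] = map x M.
Proof.
elim: M => //= j M IH; rewrite inE negb_or eq_sym.
by move=> /andP[/negbTE-> /IH->].
Qed.

(** The bounds [a], [k], [c] depend on [sigma] alone, which makes them uniform
    over all semigroups that satisfy the identity. *)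
Lemma perm_identity_jump : sigma != 1%g ->
  exists a k c, forall S : semigroupType, satisfies_perm S ->
  forall (u E v : seq S) (y : S), size u = a -> size E = k.+1 -> size v = c ->
  oprod (u ++ y :: E ++ v) = oprod (u ++ E ++ y :: v).
Proof.
move=> /perm_breaks_succ[i [i' [ii' nadj]]].
set L := map sigma (enum 'I_n.+1).
have sizeL : size L = n.+1 by rewrite size_map size_enum_ord.
have nthL j : nth ord0 L ((sigma^-1)%g j) = j.
  by rewrite (nth_map ord0) ?size_enum_ord ?ltn_ord // nth_ord_enum permKV.
have ltL j : (sigma^-1)%g j < size L by rewrite sizeL ltn_ord.
have uniqL : uniq L by rewrite map_inj_uniq ?enum_uniq //; apply: perm_inj.
have neq_ii' : i != i' by apply/eqP => e; move: ii'; rewrite e; lia.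
have neq_i'i : i' != i by rewrite eq_sym.
have [L1 [L2 enumE]] : exists L1 L2, enum 'I_n.+1 = L1 ++ [:: i, i' & L2].
  have [|L1 [B [L2 [eqe /eqP]]]] := @split_at2 _ ord0 (enum 'I_n.+1) i i'.
    by rewrite ii' ltnSn -ii' size_enum_ord ltn_ord.
  rewrite ii' subnn size_eq0 => /eqP B0.
  by exists L1, L2; rewrite eqe !nth_ord_enum B0.
(* Both sides come from substitutions that agree on the unpermuted word: there
   [x i; y] is followed by [x i'], and [y; x i'] is preceded by [x i]. *)
have slide (S : semigroupType) (idS : satisfies_perm S) (x : 'I_n.+1 -> S) y :
    oprod (flatten [seq if j == i then [:: x i; y] else [:: x j] | j <- L]) =
    oprod (flatten [seq if j == i' then [:: y; x i'] else [:: x j] | j <- L]).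
  rewrite -!perm_identity_words //; try by move=> j; case: ifP.
  have := enum_uniq 'I_n.+1; rewrite enumE cat_uniq /= inE !negb_or.
  case/and5P=> _ /and3P[iL1 i'L1 _] /andP[_ iL2] i'L2 _.
  rewrite !map_cat !flatten_cat /= !eqxx (negbTE neq_ii') (negbTE neq_i'i).
  by rewrite !flatten_subst_off.
(* The letters of [L] are distinct, so any word of length [n.+1] is an
   instance of [L]. *)
have assign (S : semigroupType) (s : S) W : size W = n.+1 ->
    exists x : 'I_n.+1 -> S, map x L = W.
  move=> sW; exists (fun j => nth s W ((sigma^-1)%g j)); apply: (@eq_from_nth _ s).
    by rewrite size_map sizeL sW.
  move=> j; rewrite size_map => jL; rewrite (nth_map ord0) //.
  move: (jL); rewrite sizeL => jn; rewrite (nth_map ord0) ?size_enum_ord //.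
  by rewrite permK (nth_enum_ord ord0).
case: (ltngtP ((sigma^-1)%g i) ((sigma^-1)%g i'))
  => [lt_ii'|lt_i'i|/val_inj/perm_inj].
(* [L = A i B i' C], where [B] is nonempty by the choice of [i]: the new letter
   jumps over [B]. *)
- have [|A [B [C [LE sB]]]] :=
    @split_at2 _ ord0 L ((sigma^-1)%g i) ((sigma^-1)%g i').
    by rewrite lt_ii' ltL.
  rewrite !nthL in LE.
  exists (size A).+1, (size B).-1, (size C).+1 => S idS u E v y su sE sv.
  have [|x] := assign S y (u ++ E ++ v).
    by rewrite -sizeL LE !size_cat /= size_cat /= su sE sv sB; lia.
  rewrite LE map_cat /= map_cat /= -cat_rcons => /eqP.
  rewrite eqseq_cat ?size_rcons ?size_map //; case/andP=> /eqP<-.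
  rewrite eqseq_cat ?size_map; last by rewrite sE sB; lia.
  case/andP=> /eqP<- /eqP<-.
  have := slide S idS x y; move: uniqL; rewrite LE.
  rewrite cat_uniq /= has_cat /= cat_uniq /= !mem_cat !inE !negb_or.
  case/and5P=> _ /and4P[iA _ i'A _] /and3P[iB _ iC] _.
  move=> /andP[/andP[i'B _] /andP[i'C _]].
  rewrite !map_cat /= !map_cat /= !flatten_cat /= !flatten_cat /= !eqxx.
  rewrite (negbTE neq_ii') (negbTE neq_i'i) !flatten_subst_off //=.
  by rewrite !cat_rcons.
(* [L = A i' B i C]: the new letter jumps over [i' B i]. *)
- have [|A [B [C [LE sB]]]] :=
    @split_at2 _ ord0 L ((sigma^-1)%g i') ((sigma^-1)%g i).
    by rewrite lt_i'i ltL.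
  rewrite !nthL in LE.
  exists (size A), (size B).+1, (size C) => S idS u E v y su sE sv.
  have [|x] := assign S y (u ++ E ++ v).
    by rewrite -sizeL LE !size_cat /= size_cat /= su sE sv; lia.
  rewrite LE map_cat /= map_cat /= -[_ :: _ ++ _]cat_cons -cat_rcons => /eqP.
  rewrite eqseq_cat ?size_rcons ?size_map //; case/andP=> /eqP<-.
  rewrite eqseq_cat ?size_rcons /= ?size_map; last by rewrite sE.
  case/andP=> /eqP<- /eqP<-.
  have := slide S idS x y; move: uniqL; rewrite LE.
  rewrite cat_uniq /= has_cat /= cat_uniq /= !mem_cat !inE !negb_or.
  case/and5P=> _ /and4P[iA _ i'A _] /and3P[iB _ iC] _.
  move=> /andP[/andP[i'B _] /andP[i'C _]].
  rewrite !map_cat /= !map_cat /= !flatten_cat /= !flatten_cat /= !eqxx.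
  rewrite (negbTE neq_ii') (negbTE neq_i'i) !flatten_subst_off //=.
  by rewrite !cat_rcons => ->.
- by move=> e; rewrite e eqxx in neq_ii'.
Qed.

(** With [E = z E'] of length [k.+1], the letter [x] jumps forward over the
    [k.+2] letters [y z E'], read as [k.+1] letters by fusing [y] and [z], and
    jumps back over the [k.+1] letters [z E']; in total it has passed [y]. *)
Lemma perm_identity_commute : sigma != 1%g ->
  exists m, forall S : semigroupType, satisfies_perm S ->
  forall (u v : seq S) (x y : S), m <= size u -> m <= size v ->
  oprod (u ++ x :: y :: v) = oprod (u ++ y :: x :: v).
Proof.
move=> /perm_identity_jump[a [k [c jump]]]; exists (a + k.+1 + c) => S idS.
have jump' (u E v : seq S) (y : S) :
    a <= size u -> size E = k.+1 -> c <= size v ->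
    oprod (u ++ y :: E ++ v) = oprod (u ++ E ++ y :: v).
  move=> su sE sv; rewrite -(cat_take_drop (size u - a) u) -(cat_take_drop c v).
  set u2 := drop _ u; set v1 := take _ v.
  have e (w : seq S) : (take (size u - a) u ++ u2) ++ w ++ drop c v =
    take (size u - a) u ++ ((u2 ++ w) ++ drop c v) by rewrite !catA.
  have -> : y :: E ++ v1 ++ drop c v = (y :: E ++ v1) ++ drop c v by rewrite /= catA.
  have -> : E ++ y :: v1 ++ drop c v = (E ++ y :: v1) ++ drop c v by rewrite -!catA.
  rewrite !e [LHS]oprod_cat [RHS]oprod_cat; congr omul.
  rewrite [LHS]oprod_cat [RHS]oprod_cat; congr omul.
  by apply: jump; rewrite // ?size_drop ?size_takel // subKn.
move=> u v x y su sv.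
have kv : k.+1 <= size v by lia.
rewrite -(cat_take_drop k.+1 v); set E := take _ v; set v' := drop _ v.
have sE : size E = k.+1 by apply: size_takel.
have sv' : c <= size v' by rewrite size_drop; lia.
case: E sE => // z E' [sE'].
have fuse : oprod (u ++ x :: ((y * z)%g :: E') ++ v') =
    oprod (u ++ ((y * z)%g :: E') ++ x :: v') by apply: jump' => //=; lia.
have unfuse (w w' : seq S) : oprod (w ++ (y * z)%g :: w') = oprod (w ++ y :: z :: w').
  by rewrite !oprod_cat !oprod_cons [omul (Some y) _]omulA.
have jump_tail : oprod (rcons u y ++ x :: (z :: E') ++ v') =
    oprod (rcons u y ++ (z :: E') ++ x :: v').
  by apply: jump'; rewrite // ?size_rcons /= ?sE' //; lia.
rewrite -cat_rcons -[in RHS]cat_rcons jump_tail !cat_rcons.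
by rewrite -[RHS]unfuse -[RHS]fuse -[in RHS]cat_rcons unfuse cat_rcons.
Qed.

Lemma perm_identity_perm_eq : sigma != 1%g ->
  exists m, forall S : semigroupType, satisfies_perm S ->
  forall u v w w' : seq S, m <= size u -> m <= size v -> perm_eq w w' ->
  oprod (u ++ w ++ v) = oprod (u ++ w' ++ v).
Proof.
move=> /perm_identity_commute[m comm]; exists m => S idS u v w w' su sv.
have move_front (u0 w1 w2 : seq S) x : m <= size u0 ->
    oprod (u0 ++ x :: w1 ++ w2 ++ v) = oprod (u0 ++ w1 ++ x :: w2 ++ v).
  elim: w1 u0 => [|y w1 IH] u0 su0 //=.
  rewrite comm //; last by rewrite !size_cat; lia.
  by rewrite -!(cat_rcons y) IH // size_rcons leqW.
elim: w u w' su => [|x w IH] u w' su.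
  by rewrite perm_sym => /perm_nilP->.
move=> eq_ww'; have xw' : x \in w' by rewrite -(perm_mem eq_ww') mem_head.
case/splitPr: xw' eq_ww' => w1 w2.
rewrite perm_sym (perm_catCA w1 [:: x] w2) /= perm_cons perm_sym => eq_w.
rewrite -catA /= -move_front // -!(cat_rcons x) [w1 ++ _]catA.
by apply: IH; rewrite // size_rcons leqW.
Qed.

End PermutationIdentity.

(** * Programs with two registers *)

Section Programs.
Variables (S : finSemigroupType) (Sigma : {set S}).
Implicit Types (p q : seq (instr S)) (s t : S) (u v w : seq S).

Lemma slp_run_cat p q r :
  slp_run Sigma (p ++ q) r = obind (slp_run Sigma q) (slp_run Sigma p r).
Proof.
elim: p r => //= -[k s|k i j] p IH r; first by case: ifP.
by case: (r i) => // a; case: (r j).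
Qed.

(** Register 0 holds the value and register 1 is kept free for loading letters.
    The empty word is excluded because its value [None] would read as an
    unassigned register. *)
Definition computable2 (l : nat) (w : seq S) : Prop :=
  exists p, [/\ size p = l, all (gtn 2) (flatten [seq instr_regs a | a <- p])
    & exists2 r, slp_run Sigma p (fun=> None) = Some r
               & r 0 = oprod w /\ w != [::]].

Lemma computable2_extend l w q w' : computable2 l w -> w' != [::] ->
  all (gtn 2) (flatten [seq instr_regs a | a <- q]) ->
  (forall r t, r 0 = Some t -> oprod w = Some t ->
     exists2 r', slp_run Sigma q r = Some r' & r' 0 = oprod w') ->
  computable2 (l + size q) w'.
Proof.
move=> [p [sp rp [r runp [r0 w0]]]] w'0 rq runq.
have [t wt] := oprodE w0.
have [|r' runq' r'0] := runq r t _ wt; first by rewrite r0.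
exists (p ++ q); split; first by rewrite size_cat sp.
  by rewrite map_cat flatten_cat all_cat rp.
by exists r'; rewrite // slp_run_cat runp.
Qed.

Lemma computable2_letter s : s \in Sigma -> computable2 1 [:: s].
Proof.
move=> sS; exists [:: Const 0 s]; split=> //=; rewrite sS.
by eexists; split=> //=; rewrite oprod1.
Qed.

Lemma computable2_rcons l w s : s \in Sigma -> computable2 l w ->
  computable2 (l + 2) (rcons w s).
Proof.
move=> sS; move/(@computable2_extend _ _ [:: Const 1 s; Mul 0 0 1]); apply=> //.
  by case: w.
move=> r t r0 wt /=; rewrite sS /= r0.
by eexists; [reflexivity | rewrite oprod_rcons wt].
Qed.

Lemma computable2_cons l w s : s \in Sigma -> computable2 l w ->
  computable2 (l + 2) (s :: w).
Proof.
move=> sS; move/(@computable2_extend _ _ [:: Const 1 s; Mul 0 1 0]); apply=> //.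
move=> r t r0 wt /=; rewrite sS /= r0.
by eexists; [reflexivity | rewrite oprod_cons wt].
Qed.

Lemma computable2_square l w : computable2 l w -> computable2 l.+1 (w ++ w).
Proof.
move=> cw; rewrite -addn1.
apply: (computable2_extend cw (q := [:: Mul 0 0 0])) => //.
  by have [p [_ _ [r _ [_]]]] := cw; case: (w).
move=> r t r0 wt /=; rewrite r0.
by eexists; [reflexivity | rewrite oprod_cat wt].
Qed.

Lemma computable2_catr l w v : all (mem Sigma) v -> computable2 l w ->
  computable2 (l + 2 * size v) (w ++ v).
Proof.
elim: v l w => [|s v IH] l w /=; first by rewrite muln0 addn0 cats0.
case/andP=> sS vS cw; rewrite mulnS addnA -cat_rcons.
exact/IH/computable2_rcons.
Qed.

Lemma computable2_catl l w u : all (mem Sigma) u -> computable2 l w ->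
  computable2 (l + 2 * size u) (u ++ w).
Proof.
elim/last_ind: u l w => [|u s IH] l w /=; first by rewrite muln0 addn0.
rewrite all_rcons => /andP[sS uS] cw; rewrite size_rcons mulnS addnA cat_rcons.
exact/IH/computable2_cons.
Qed.

Lemma computable2_word w : w != [::] -> all (mem Sigma) w ->
  computable2 (2 * size w).-1 w.
Proof.
case: w => // s w _ /andP[sS wS].
have -> : (2 * size (s :: w)).-1 = 1 + 2 * size w.
  by rewrite [size (_ :: _)]/= mulnS.
exact: (computable2_catr wS (computable2_letter sS)).
Qed.

Lemma slp_cost_computable2 l w t : t \in gen_sg Sigma ->
  oprod w = Some t -> computable2 l w -> slp_cost 2 Sigma t <= l.
Proof.
move=> tS wt [p [<- rp [r runp [r0 _]]]].
have [_] := slp_cost_attained (leqnn 2) tS; apply.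
  apply: (@uniq_leq_size _ _ [:: 0; 1]); first exact: undup_uniq.
  by move=> k; rewrite mem_undup => /(allP rp); case: k => [|[]].
by exists r; rewrite // -wt -r0; exists 0.
Qed.

Lemma gen_sg_word t : t \in gen_sg Sigma ->
  exists w, all (mem Sigma) w /\ oprod w = Some t.
Proof.
pose A := [set t | `[< exists w, all (mem Sigma) w /\ oprod w = Some t >]]%SET.
move=> /bigcapP/(_ A) tA; apply/asboolP; rewrite inE in tA; apply: tA.
apply/andP; split.
  apply/fintype.subsetP => s sS; rewrite inE; apply/asboolP; exists [:: s].
  by rewrite /= sS oprod1.
apply/forall_inP => a; rewrite inE => /asboolP[u [uS ua]].
apply/forall_inP => b; rewrite inE => /asboolP[v [vS vb]].
rewrite inE; apply/asboolP; exists (u ++ v).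
by rewrite all_cat uS vS oprod_cat ua vb.
Qed.

End Programs.

(** * Multisets as words, and halving *)

Section Multisets.
Variable T : finType.
Implicit Types (f : T -> nat) (w : seq T).

Definition word f : seq T := flatten [seq nseq (f s) s | s <- enum T].

Lemma count_word f s : count_mem s (word f) = f s.
Proof.
rewrite count_flatten -map_comp sumnE big_map big_enum (bigD1 s) //=.
rewrite count_nseq /= eqxx mul1n big1 ?addn0 // => x /negbTE xs.
by rewrite /= count_nseq /= xs.
Qed.

Lemma perm_word w : perm_eq w (word (fun s => count_mem s w)).
Proof. by apply/allP => x _ /=; rewrite count_word. Qed.

Lemma size_word f : size (word f) = \sum_s f s.
Proof.
rewrite size_flatten /shape -map_comp sumnE big_map big_enum.
by apply: eq_bigr => s _; rewrite /= size_nseq.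
Qed.

Lemma size_count w : size w = \sum_s count_mem s w.
Proof. by rewrite (perm_size (perm_word w)) size_word. Qed.

Lemma mem_word f s : (s \in word f) = (0 < f s).
Proof. by rewrite -has_pred1 has_count count_word. Qed.

(** The number of sub-multisets of [w]. *)
Definition num_subwords w : nat := \prod_s (count_mem s w).+1.
Definition sum_sq w : nat := \sum_s count_mem s w ^ 2.

(** For [n = 2 * k + 1] the inequality is [4 * k.+1 ^ 3 <= 8 * k.+1 ^ 3]. *)
Lemma pow_halving (n : nat) : 2 ^ (2 * odd n) * n./2.+1 ^ 3 <= n.+1 ^ 3.
Proof.
by rewrite -{3}[n]odd_double_half; case: (odd n) => /=; rewrite !expnS expn0; nia.
Qed.

(** The spare factor 2 pays for one squaring.  The exponent 3 is the least that
    provides it: for odd [n] two powers of 2 are already spent on loading and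
    multiplying a letter. *)
Lemma pow_halving_strict (n : nat) : 0 < n./2 ->
  2 * (2 ^ (2 * odd n) * n./2.+1 ^ 3) <= n.+1 ^ 3.
Proof.
rewrite -{4}[n]odd_double_half; move: n./2 => k k0.
by case: (odd n) => /=; rewrite !expnS expn0; nia.
Qed.

Definition halves w := word (fun s => (count_mem s w)./2).
Definition parities w := word (fun s => odd (count_mem s w)).

(** The exponent of 2 on the left bounds the number of instructions that lead from
    [halves w] to [w]: a squaring, unless there is nothing to square, and two
    per letter of odd multiplicity. *)
Lemma num_subwords_halving w :
  2 ^ ((halves w != [::]) + 2 * size (parities w)) * num_subwords (halves w) ^ 3
    <= num_subwords w ^ 3.
Proof.
have cube F : (\prod_(s : T) F s) ^ 3 = \prod_s F s ^ 3.
  exact: (big_morph (fun x => x ^ 3) (fun x y => expnMn x y 3) (exp1n 3)).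
rewrite /num_subwords size_word expnD big_distrr /=.
rewrite (big_morph (fun k => 2 ^ k) (expnD 2) (expn0 2)) !cube -mulnA -big_split /=.
under eq_bigr do rewrite count_word.
have le_s s : 2 ^ (2 * odd (count_mem s w)) * (count_mem s w)./2.+1 ^ 3 <=
    (count_mem s w).+1 ^ 3 by apply: pow_halving.
have [h0|] := eqVneq (halves w) [::]; first by rewrite mul1n leq_prod.
rewrite -size_eq0 -lt0n -has_predT => /hasP[s]; rewrite mem_word => s0 _.
rewrite (bigD1 s) //= [leqRHS](bigD1 s) //= mulnA; apply: leq_mul.
  exact: pow_halving_strict.
by apply: leq_prod => j _; apply: le_s.
Qed.

Lemma perm_halving w : perm_eq w (halves w ++ halves w ++ parities w).
Proof.
apply/allP => x _ /=; rewrite !count_cat !count_word.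
by rewrite -{1}[count_mem x w]odd_double_half -addnn addnC addnA.
Qed.

End Multisets.

(** * Horner evaluation and optimal representations *)

Lemma horner_program (S : finSemigroupType) (Sigma : {set S}) (w : seq S) :
    w != [::] -> all (mem Sigma) w ->
  exists l w', [/\ perm_eq w w', computable2 Sigma l w'
                 & 2 ^ l <= num_subwords w ^ 3].
Proof.
have [k] := ubnP (size w); elim: k w => // k IH w sw w0 wS.
have eq_w := perm_halving w; have le_w := num_subwords_halving w.
move: eq_w le_w; set h := halves w; set b := parities w => eq_w le_w.
have [hS bS] : all (mem Sigma) h /\ all (mem Sigma) b.
  by move: wS; rewrite (perm_all _ eq_w) !all_cat => /and3P[].
have [h0|h0] := eqVneq h [::].
  exists (2 * size b).-1, b; rewrite h0 /= in eq_w.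
  split=> //.
    by apply: computable2_word; rewrite // -size_eq0 -(perm_size eq_w) size_eq0.
  apply: leq_trans le_w; rewrite h0 eqxx add0n.
  rewrite -[leqLHS]muln1 leq_mul ?leq_exp2l ?leq_pred ?expn_gt0 //.
  by apply/orP; left; rewrite prodn_gt0.
have sh : size h < k.
  rewrite -ltnS; apply: leq_trans sw; rewrite ltnS (perm_size eq_w) !size_cat.
  by rewrite -[ltnLHS]addn0 ltn_add2l addn_gt0 lt0n size_eq0 h0.
have [l [h' [eq_h ch le_l]]] := IH h sh h0 hS.
exists (l.+1 + 2 * size b), ((h' ++ h') ++ b); split.
- by rewrite (permPl eq_w) -catA !perm_cat.
- exact/computable2_catr/computable2_square.
- apply: leq_trans le_w; rewrite h0 addSnnS expnD mulnC.
  by rewrite leq_mul2l le_l orbT.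
Qed.

Section Exchange.
Variables (S : finSemigroupType) (Sigma : {set S}) (t : S) (p q : seq S).
Hypothesis p0 : p != [::].
Hypothesis middle_perm : forall w w' : seq S, perm_eq w w' ->
  oprod (p ++ w ++ q) = oprod (p ++ w' ++ q).

Definition middle : pred (seq S) :=
  fun w => all (mem Sigma) w && (oprod (p ++ w ++ q) == Some t).

(** Sizes are minimized first: for a fixed size there are finitely many words,
    hence one with the largest sum of squares. *)
Lemma optimal_middle w0 : middle w0 -> exists w, [/\ middle w,
  forall w', middle w' -> size w <= size w'
  & forall w', middle w' -> size w' = size w -> sum_sq w' <= sum_sq w].
Proof.
move=> mw0; pose ok k := [exists w : k.-tuple S, middle w].
have [|k /existsP[w1 mw1] min_k] := @ex_minnP ok.
  by exists (size w0); apply/existsP; exists (in_tuple w0).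
case: (@arg_maxnP _ w1 (fun w : k.-tuple S => middle w) (fun w => sum_sq w) mw1).
move=> w mw max_w; exists w; split=> // w' mw'.
  by rewrite size_tuple; apply: min_k; apply/existsP; exists (in_tuple w').
rewrite size_tuple => /eqP sw'; exact: (max_w (Tuple sw') mw').
Qed.

(** Write [w] as [f e], where [e] is the complement of [f].  Then
    [p f e q = (p f) (e q) = (p f') (e q)], so [f' e] is a middle as well.
    Equality after the prefix [p] suffices because [f] can be moved next to
    it. *)
Lemma exchange_middle w (f f' : S -> nat) : middle w ->
    (forall s, f s <= count_mem s w) -> (forall s, f' s <= count_mem s w) ->
    oprod (p ++ word f) = oprod (p ++ word f') ->
  middle (word (fun s => (count_mem s w - f s) + f' s)).
Proof.
move=> /andP[wS /eqP wt] fw f'w eqf; pose e s := count_mem s w - f s.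
apply/andP; split.
  apply/allP => s; rewrite mem_word => s0; apply: (allP wS).
  rewrite -has_pred1 has_count lt0n; apply: contraTneq s0 => c0.
  by have := f'w s; rewrite c0 leqn0 => /eqP->.
apply/eqP; rewrite -wt.
have eq_w : perm_eq w (word f ++ word e).
  by apply/allP => s _; rewrite /= count_cat !count_word /e subnKC.
rewrite (middle_perm eq_w).
rewrite -(@middle_perm (word f' ++ word e)); last first.
  by apply/allP => s _; rewrite /= count_cat !count_word addnC.
by rewrite -!catA catA oprod_cat -eqf -oprod_cat -!catA.
Qed.

Lemma sum_exchange (e f f' : nat) : f <= e -> f' <= e ->
  ((e - f) + f') + ((e - f') + f) = e + e.
Proof. lia. Qed.

(** Strict convexity of the square: the two exchanged multiplicities are
    [e + d] and [e - d] with [d = f' - f]. *)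
Lemma sq_exchange (e f f' : nat) : f <= e -> f' <= e ->
  2 * e ^ 2 + (f != f') <= ((e - f) + f') ^ 2 + ((e - f') + f) ^ 2.
Proof.
wlog le_ff' : f f' / f <= f'.
  move=> H fe f'e; case/orP: (leq_total f f') => ff'; first exact: H.
  by rewrite [leqRHS]addnC eq_sym; apply: H.
move=> _ /subnK<-; move: le_ff' => /subnK<-.
move: (f' - f) => d; move: (e - (d + f)) => g.
have -> : g + (d + f) - f + (d + f) = (g + f + d) + d by lia.
have -> : g + (d + f) - (d + f) + f = g + f by lia.
have : (f != d + f) <= d by case: eqVneq => //; lia.
rewrite addnCA; move: (g + f) (nat_of_bool _) => a b; nia.
Qed.

(** Two sub-multisets with the same value after [p] could be exchanged in both
    directions.  By minimality of the size neither exchange shortens [w], so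
    both preserve its size, and then one of them increases the sum of squares
    unless the sub-multisets agree. *)
Lemma optimal_num_subwords w : middle w ->
    (forall w', middle w' -> size w <= size w') ->
    (forall w', middle w' -> size w' = size w -> sum_sq w' <= sum_sq w) ->
  num_subwords w <= #|S|.
Proof.
move=> mw min_w max_w; pose e s := count_mem s w.
have pf_neq0 (f : {dffun forall s, 'I_(e s).+1}) : p ++ word (fun s => f s) != [::].
  by case: (p) p0.
have [g gE] := fin_all_exists (fun f => oprodE (pf_neq0 f)).
have g_inj : injective g.
  move=> f f' eqg.
  have eqp : oprod (p ++ word (fun s => f s)) = oprod (p ++ word (fun s => f' s)).
    by rewrite !gE eqg.
  have fe s : f s <= count_mem s w by rewrite -ltnS ltn_ord.
  have f'e s : f' s <= count_mem s w by rewrite -ltnS ltn_ord.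
  have m1 := exchange_middle mw fe f'e eqp.
  have m2 := exchange_middle mw f'e fe (esym eqp).
  have s1 := min_w _ m1; have s2 := min_w _ m2.
  have : size (word (fun s => count_mem s w - f s + f' s)) +
         size (word (fun s => count_mem s w - f' s + f s)) = size w + size w.
    rewrite !size_word size_count -!big_split; apply: eq_bigr => s _ /=.
    exact: sum_exchange.
  move=> s12.
  have balanced a b c : c <= a -> c <= b -> a + b = c + c -> a = c /\ b = c by lia.
  have [e1 e2] := balanced _ _ _ s1 s2 s12.
  have q1 := max_w _ m1 e1; have q2 := max_w _ m2 e2.
  have : \sum_s (2 * count_mem s w ^ 2 + (f s != f' s :> nat)) <=
    sum_sq (word (fun s => count_mem s w - f s + f' s)) +
    sum_sq (word (fun s => count_mem s w - f' s + f s)).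
    rewrite -big_split; apply: leq_sum => s _; rewrite !count_word.
    exact: sq_exchange.
  rewrite big_split -big_distrr /= -/(sum_sq w) => le_sq.
  have := leq_trans le_sq (leq_add q1 q2).
  rewrite addnn -mul2n -[leqRHS]addn0 leq_add2l leqn0 sum_nat_eq0.
  move=> /forallP eq0; apply/ffunP => s; apply/val_inj/eqP.
  by have := eq0 s; rewrite /= eqb0 negbK.
have := leq_card g g_inj; apply: leq_trans.
rewrite card_dep_ffun foldrE big_map big_enum /num_subwords.
by apply: leq_prod => s _; rewrite card_ord.
Qed.

End Exchange.

(** * Asymptotics *)

(** The constant is the cost of the prefix and suffix, of length [m.+1] each, at
    two instructions per letter.  It also covers the words that are too short to
    have a commutative middle.  The length [m.+1] instead of [m] makes the
    prefix nonempty, so that it has a value even when nothing follows it. *)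
Lemma permutative_slp_cost (V : finSemigroupType -> Prop) : permutative V ->
  exists c, forall S : finSemigroupType, V S ->
  forall (Sigma : {set S}) (t : S), t \in gen_sg Sigma ->
  exists2 l, 2 ^ l <= #|S| ^ 3 & slp_cost 2 Sigma t <= l + c.
Proof.
move=> [n [sigma [sigma1 idV]]].
have [m mid] := perm_identity_perm_eq sigma1.
exists (4 * m.+1) => S VS Sigma t tS; have idS : satisfies_perm sigma S := idV S VS.
have [w0 [w0S w0t]] := gen_sg_word tS.
have short w : all (mem Sigma) w -> oprod w = Some t -> size w <= 2 * m.+1 ->
    exists2 l, 2 ^ l <= #|S| ^ 3 & slp_cost 2 Sigma t <= l + 4 * m.+1.
  move=> wS wt sw; exists 0.
    by rewrite expn_gt0; apply/orP; left; apply/card_gt0P; exists t.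
  have w0' : w != [::] by apply/eqP => e; rewrite e /oprod big_nil in wt.
  apply: leq_trans (slp_cost_computable2 tS wt (computable2_word w0' wS)) _.
  by apply: leq_trans (leq_pred _) _; rewrite add0n -[4]/(2 * 2) -mulnA leq_mul2l.
have [|long] := leqP (size w0) (2 * m.+1); first exact: short.
pose p := take m.+1 w0; pose q := drop (size w0 - m.+1) w0.
have sp : size p = m.+1 by rewrite size_takel //; lia.
have sq : size q = m.+1 by rewrite size_drop subKn //; lia.
have p0 : p != [::] by rewrite -size_eq0 sp.
have mid_perm (w w' : seq S) : perm_eq w w' ->
    oprod (p ++ w ++ q) = oprod (p ++ w' ++ q).
  by apply: mid; rewrite // ?sp ?sq.
have [w1 w0E] : exists w1, w0 = p ++ w1 ++ q.
  exists (take (size w0 - 2 * m.+1) (drop m.+1 w0)); rewrite /p /q.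
  have -> : size w0 - m.+1 = (size w0 - 2 * m.+1) + m.+1 by lia.
  by rewrite -drop_drop !cat_take_drop.
have := w0S; rewrite w0E !all_cat => /and3P[pS w1S qS].
have [|w [mw min_w max_w]] := @optimal_middle S Sigma t p q w1.
  by rewrite /middle w1S -w0E w0t eqxx.
have le_w := optimal_num_subwords p0 mid_perm mw min_w max_w.
case/andP: mw => wS /eqP wt.
have [we|wn] := eqVneq w [::].
  apply: (short _ _ wt); first by rewrite !all_cat pS wS.
  by rewrite we !size_cat /= sp sq; lia.
have [l [w' [eq_w cw le_l]]] := horner_program wn wS.
exists l; first by apply: leq_trans le_l _; rewrite leq_exp2r.
have cpwq := computable2_catl pS (computable2_catr qS cw).
rewrite (mid_perm _ _ eq_w) in wt.
apply: leq_trans (slp_cost_computable2 tS wt cpwq) _.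
by rewrite sp sq; lia.
Qed.

Lemma permutative_C_pv (V : finSemigroupType -> Prop) : permutative V ->
  exists c, forall N, 0 < N -> exists2 l, 2 ^ l <= N ^ 3 & C_pv 2 V N <= l + c.
Proof.
move=> /permutative_slp_cost[c costV]; exists c => N N0.
rewrite /C_pv /nat_max; case: xgetP => [m -> [[S [VS SN ->]] _]|_]; last first.
  (* without a maximum, [C_pv] takes the default value 0 *)
  by exists 0; rewrite ?expn_gt0 ?N0.
exists (trunc_log 2 (N ^ 3)); first by apply: trunc_logP; rewrite ?expn_gt0 ?N0.
apply/bigmax_leqP => Sigma _; apply/bigmax_leqP => t tS.
have [l le_l le_c] := costV S VS Sigma t tS.
apply: leq_trans le_c _; rewrite leq_add2r; apply: trunc_log_max => //.
by apply: leq_trans le_l _; rewrite leq_exp2r.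
Qed.

Unset Implicit Arguments.
Set Strict Implicit.

Import Order.TTheory GRing.Theory Num.Theory.

Local Open Scope classical_set_scope.
Local Open Scope ring_scope.

Theorem proposition15 (R : realType) (V : finSemigroupType -> Prop)
    (pvV : pseudovariety V) (permV : permutative V) :
  (fun N : nat => (C_pv 2 V N)%:R : R) =O_\oo (fun N : nat => ln (N%:R : R)).
Proof.
have [c boundV] := permutative_C_pv permV.
have ln2_gt0 : 0 < ln 2 :> R by rewrite ln_gt0 // ltr1n.
apply/eqO_exP; exists ((3 + c)%:R / ln 2); first by rewrite divr_gt0 ?ltr0n.
exists 2%N => // N /= N2.
have N0 : (0 < N)%N by apply: leq_trans N2.
have [l le_l le_C] := boundV N N0.
have NR : 0 < N%:R :> R by rewrite ltr0n.
(* for [N >= 2] the additive constant is absorbed by [c <= c * ln N / ln 2] *)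
have ln_le : ln 2 <= ln N%:R :> R by rewrite ler_ln ?posrE // ler_nat.
have lnl : l%:R * ln 2 <= 3 * ln N%:R :> R.
  rewrite ![_%:R * ln _]mulr_natl -!lnXn // ler_ln ?posrE ?exprn_gt0 //.
  by rewrite -!natrX ler_nat.
rewrite ger0_norm // ger0_norm; last by apply: le_trans ln_le; apply: ltW.
rewrite mulrAC ler_pdivlMr //.
apply: le_trans (_ : (l + c)%:R * ln 2 <= _).
  by rewrite ler_wpM2r ?ler_nat // ltW.
rewrite (natrD _ l) (natrD _ 3%N) 2!mulrDl lerD //.
by apply: ler_wpM2l; rewrite ?ler0n.
Qed.
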